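(* Fix $n\ge 1$ and let $\Psi\cup\{\varphi\}$ be a possibly infinite set of formulas. If $\Psi\Vdash_{\mathsf{InqBQ}_n}\varphi$, then the (possibly infinite) sequent $\{1,\dots,n\}:\Psi\Rightarrow\{1,\dots,n\}:\varphi$ is derivable in $\mathbf{G}(\mathsf{FBInqBQ})$, i.e. there is a finite $\Psi'\subseteq\Psi$ such that the finite sequent $\{1,\dots,n\}:\Psi'\Rightarrow\{1,\dots,n\}:\varphi$ is derivable in $\mathbf{G}(\mathsf{FBInqBQ})$. In particular, if $\varphi\in\mathsf{InqBQ}_n$ then $\Rightarrow\{1,\dots,n\}:\varphi$ is derivable in $\mathbf{G}(\mathsf{FBInqBQ})$.
   Context: Language: countably infinite set $\mathsf{Var}$ of variables, countably infinite set $\mathsf{Pred}$ of predicate symbols with arities (no identity, constants, function symbols). Formulas: $\varphi ::= P(x_1,\dots,x_m)\mid \bot\mid \varphi\to\varphi\mid\varphi\wedge\varphi\mid \varphi\veebar\varphi\mid \forall x\varphi\mid \bar\exists x\varphi$ ($\veebar$ inquisitive disjunction, $\bar\exists$ inquisitive existential). $\varphi[z/x]$ is capture-avoiding substitution. Semantics: a relational information model $\mathfrak M=(W,D,\mathfrak I)$ has nonempty $W$, nonempty $D$, $\mathfrak I(P,w)\subseteq D^m$; for states $s\subseteq W$ and $g:\mathsf{Var}\to D$: $s\Vdash_g P(\bar x)$ iff $g(\bar x)\in\mathfrak I(P,w)$ for all $w\in s$; $s\Vdash_g\bot$ iff $s=\varnothing$; $\wedge$ pointwise; $s\Vdash_g\varphi\to\psi$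 iff every $t\subseteq s$ supporting $\varphi$ supports $\psi$; $s\Vdash_g\varphi\veebar\psi$ iff $s\Vdash_g\varphi$ or $s\Vdash_g\psi$; $\forall x$ / $\bar\exists x$: for all / some $d\in D$, $s\Vdash_{g[x\mapsto d]}\varphi$. $\mathsf{InqBQ}_n$: formulas supported at all states under all assignments in all models with $|W|\le n$. $\Psi\Vdash_{\mathsf{InqBQ}_n}\varphi$ means: for every relational information model $\mathfrak M=(W,D,\mathfrak I)$ with $|W|\le n$, every $g$ and every $s\subseteq W$, if $\mathfrak M,s\Vdash_g\psi$ for all $\psi\in\Psi$ then $\mathfrak M,s\Vdash_g\varphi$. $\{1,\dots,n\}:\Psi:=\{\{1,\dots,n\}:\psi\mid\psi\in\Psi\}$. Calculus $\mathbf{G}(\mathsf{FBInqBQ})$: a label is a nonempty finite subset of $\omega$; a labelled formula is $X:\varphi$ with $X$ a label; a sequent $\Gamma\Rightarrow\Delta$ is a pair of finite multisets of labelled formulas. $X,Y$ range over labels. Initial sequents: $(\mathtt{id})$ $X:P(\bar x),\Gamma\Rightarrow\Delta,Y:P(\bar x)$ whenever $X\supseteq Y$; $(\bot\Rightarrow)$ $X:\bot,\Gamma\Rightarrow\Delta$. Rules (premises / conclusion): $(\Rightarrow\mathtt{at})$: $\Gamma\Rightarrow\Delta,\{k\}:P(\bar x)$ for every $k\in X$ / $\Gamma\Rightarrow\Delta,X:P(\bar x)$. $(\Rightarrow\wedge)$: $\Gamma\Rightarrow\Delta,X:\varphi$ and $\Gamma\Rightarrow\Delta,X:\psi$ / $\Gamma\Rightarrow\Delta,X:\varphi\wedge\psi$.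 $(\wedge\Rightarrow)$: $X:\varphi,X:\psi,\Gamma\Rightarrow\Delta$ / $X:\varphi\wedge\psi,\Gamma\Rightarrow\Delta$. $(\Rightarrow\veebar)$: $\Gamma\Rightarrow\Delta,X:\varphi,X:\psi$ / $\Gamma\Rightarrow\Delta,X:\varphi\veebar\psi$. $(\veebar\Rightarrow)$: $X:\varphi,\Gamma\Rightarrow\Delta$ and $X:\psi,\Gamma\Rightarrow\Delta$ / $X:\varphi\veebar\psi,\Gamma\Rightarrow\Delta$. $(\Rightarrow\to)$: $Y:\varphi,\Gamma\Rightarrow\Delta,Y:\psi$ for every label $Y\subseteq X$ / $\Gamma\Rightarrow\Delta,X:\varphi\to\psi$. $(\to\Rightarrow)$, for a label $Y\subseteq X$: $X:\varphi\to\psi,\Gamma\Rightarrow\Delta,Y:\varphi$ and $Y:\psi,X:\varphi\to\psi,\Gamma\Rightarrow\Delta$ / $X:\varphi\to\psi,\Gamma\Rightarrow\Delta$. $(\Rightarrow\forall)$: $\Gamma\Rightarrow\Delta,X:\varphi[z/x]$ / $\Gamma\Rightarrow\Delta,X:\forall x\varphi$, with $z$ not occurring in the conclusion. $(\forall\Rightarrow)$: $X:\varphi[y/x],X:\forall x\varphi,\Gamma\Rightarrow\Delta$ / $X:\forall x\varphi,\Gamma\Rightarrow\Delta$ ($y$ arbitrary). $(\Rightarrow\bar\exists)$: $\Gamma\Rightarrow\Delta,X:\bar\exists x\varphi,X:\varphi[y/x]$ / $\Gamma\Rightarrow\Delta,X:\bar\exists x\varphi$ ($y$ arbitrary). $(\bar\exists\Rightarrow)$: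 $X:\varphi[z/x],\Gamma\Rightarrow\Delta$ / $X:\bar\exists x\varphi,\Gamma\Rightarrow\Delta$, with $z$ not occurring in the conclusion. A derivation is a finite tree of sequents built from initial sequents by these rules; a finite sequent is derivable if it is the root of a derivation; a possibly infinite sequent $\Gamma\Rightarrow\Delta$ is derivable if some finite $\Gamma'\Rightarrow\Delta'$ with $\Gamma'\subseteq\Gamma$, $\Delta'\subseteq\Delta$ is derivable. *)

(* Defs.v *)
From HB Require Import structures.
From mathcomp Require Import all_boot.
From mathcomp Require Import finmap multiset.
From mathcomp Require Import boolp classical_sets functions cardinality.

Set Implicit Arguments.
Unset Strict Implicit.
Unset Printing Implicit Defensive.

(* The variables and the predicate symbols, two countably infinite sets, are
   both [nat]; [ar P] is the (arbitrary) arity of the symbol [P]. *)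
Notation var := nat (only parsing).

Inductive form (ar : nat -> nat) : Type :=
| Atom (P : nat) (xs : (ar P).-tuple var)
| Bot
| Imp (phi psi : form ar)
| And (phi psi : form ar)
| IOr (phi psi : form ar)   (* inquisitive disjunction *)
| All (x : var) (phi : form ar)
| IEx (x : var) (phi : form ar).   (* inquisitive existential *)
Arguments Bot {ar}.

Section FormCountable.
Variable ar : nat -> nat.

Let code := ({P : nat & (ar P).-tuple var} + nat)%type.

Fixpoint form_encode (phi : form ar) : GenTree.tree code :=
  match phi with
  | Atom P xs => GenTree.Leaf (inl (Tagged (fun P => (ar P).-tuple var) xs))
  | Bot => GenTree.Node 0 [::]
  | Imp phi psi => GenTree.Node 1 [:: form_encode phi; form_encode psi]
  | And phi psi => GenTree.Node 2 [:: form_encode phi; form_encode psi]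
  | IOr phi psi => GenTree.Node 3 [:: form_encode phi; form_encode psi]
  | All x phi => GenTree.Node 4 [:: GenTree.Leaf (inr x); form_encode phi]
  | IEx x phi => GenTree.Node 5 [:: GenTree.Leaf (inr x); form_encode phi]
  end.

Fixpoint form_decode (t : GenTree.tree code) : option (form ar) :=
  match t with
  | GenTree.Leaf (inl (existT P xs)) => Some (Atom xs)
  | GenTree.Node 0 [::] => Some Bot
  | GenTree.Node 1 [:: t; u] =>
      if (form_decode t, form_decode u) is (Some phi, Some psi)
      then Some (Imp phi psi) else None
  | GenTree.Node 2 [:: t; u] =>
      if (form_decode t, form_decode u) is (Some phi, Some psi)
      then Some (And phi psi) else None
  | GenTree.Node 3 [:: t; u] =>
      if (form_decode t, form_decode u) is (Some phi, Some psi)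
      then Some (IOr phi psi) else None
  | GenTree.Node 4 [:: GenTree.Leaf (inr x); t] => omap (All x) (form_decode t)
  | GenTree.Node 5 [:: GenTree.Leaf (inr x); t] => omap (IEx x) (form_decode t)
  | _ => None
  end.

Lemma form_encodeK : pcancel form_encode form_decode.
Proof. by elim=> //= [phi -> psi ->|phi -> psi ->|phi -> psi ->|x phi ->|x phi ->]. Qed.

HB.instance Definition _ := Countable.copy (form ar) (pcan_type form_encodeK).
End FormCountable.

Section Syntax.
Variable ar : nat -> nat.
Implicit Type phi psi : form ar.

(* All variables occurring in a formula: free, bound, or in a quantifier prefix. *)
Fixpoint vars phi : seq var :=
  match phi with
  | Atom _ xs => xs
  | Bot => [::]
  | Imp phi psi | And phi psi | IOr phi psi => vars phi ++ vars psi
  | All x phi | IEx x phi => x :: vars phi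
  end.

Fixpoint fv phi : seq var :=
  match phi with
  | Atom _ xs => xs
  | Bot => [::]
  | Imp phi psi | And phi psi | IOr phi psi => fv phi ++ fv psi
  | All x phi | IEx x phi => [seq y <- fv phi | y != x]
  end.

(* The bound variable replacing [x] when the simultaneous substitution [sigma]
   is pushed under a quantifier on [x] whose matrix has the free variables
   [ys] (including possibly [x]): it is [x] itself unless [x] would capture a
   substituted variable, and otherwise a variable that captures none. *)
Definition rebind (sigma : var -> var) (x : var) (ys : seq var) : var :=
  let im := [seq sigma y | y <- ys & y != x] in
  if x \in im then (\max_(y <- im) y).+1 else x.

Fixpoint ssubst (sigma : var -> var) phi : form ar :=
  match phi with
  | Atom P xs => Atom (map_tuple sigma xs)
  | Bot => Bot
  | Imp phi psi => Imp (ssubst sigma phi) (ssubst sigma psi)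
  | And phi psi => And (ssubst sigma phi) (ssubst sigma psi)
  | IOr phi psi => IOr (ssubst sigma phi) (ssubst sigma psi)
  | All x phi =>
      let x' := rebind sigma x (fv phi) in
      All x' (ssubst [eta sigma with x |-> x'] phi)
  | IEx x phi =>
      let x' := rebind sigma x (fv phi) in
      IEx x' (ssubst [eta sigma with x |-> x'] phi)
  end.

(* phi[z/x] *)
Definition subst (z x : var) phi : form ar := ssubst [eta id with x |-> z] phi.

End Syntax.

Record model (ar : nat -> nat) := Model {
  world : Type;
  dom : Type;
  world_inh : inhabited world;
  dom_inh : inhabited dom;
  interp : forall P : nat, world -> set ((ar P).-tuple dom)
}.

Section Semantics.
Local Open Scope classical_set_scope.
Local Open Scope card_scope.
Variable ar : nat -> nat.

Fixpoint supports (M : model ar) (s : set (world M)) (g : var -> dom M)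
    (phi : form ar) : Prop :=
  match phi with
  | Atom P xs => forall w, s w -> interp w (map_tuple g xs)
  | Bot => s = set0
  | Imp phi psi => forall t, t `<=` s -> supports t g phi -> supports t g psi
  | And phi psi => supports s g phi /\ supports s g psi
  | IOr phi psi => supports s g phi \/ supports s g psi
  | All x phi => forall d, supports s [eta g with x |-> d] phi
  | IEx x phi => exists d, supports s [eta g with x |-> d] phi
  end.

Definition at_most_worlds (n : nat) (M : model ar) : Prop :=
  [set: world M] #<= `I_n.

Definition InqBQ (n : nat) : set (form ar) :=
  [set phi | forall M : model ar, at_most_worlds n M ->
     forall (g : var -> dom M) (s : set (world M)), supports s g phi].

Definition entails (n : nat) (Psi : set (form ar)) (phi : form ar) : Prop :=
  forall M : model ar, at_most_worlds n M ->
  forall (g : var -> dom M) (s : set (world M)),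
    (forall psi, Psi psi -> supports s g psi) -> supports s g phi.

End Semantics.

Section Calculus.
Local Open Scope fset_scope.
Local Open Scope mset_scope.
Variable ar : nat -> nat.

Definition label := {X : {fset nat} | X != fset0}.

Lemma label1_subproof (k : nat) : [fset k] != fset0.
Proof. by apply/fset0Pn; exists k; rewrite inE. Qed.

(* the label {k} *)
Definition label1 (k : nat) : label := Sub [fset k] (label1_subproof k).

Lemma label_upto_subproof (n : nat) : 0 < n -> [fset k in iota 1 n] != fset0.
Proof. by move=> n0; apply/fset0Pn; exists 1; rewrite !inE mem_iota. Qed.

(* the label {1, ..., n} *)
Definition label_upto (n : nat) (n_gt0 : 0 < n) : label :=
  Sub [fset k in iota 1 n] (label_upto_subproof n_gt0).

Local Notation lform := (label * form ar)%type.

Definition occurs (z : var) (G : {mset lform}) : bool :=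
  has (fun A : lform => z \in vars A.2) G.

Implicit Types (G D : {mset lform}) (X Y : label) (phi psi : form ar).

Inductive derivable : {mset lform} -> {mset lform} -> Prop :=
| d_id X Y P (xs : (ar P).-tuple var) G D :
    (val Y `<=` val X)%fset ->
    derivable ((X, Atom xs) +` G) ((Y, Atom xs) +` D)
| d_botL X G D :
    derivable ((X, Bot) +` G) D
| d_atR X P (xs : (ar P).-tuple var) G D :
    (forall k, k \in val X -> derivable G ((label1 k, Atom xs) +` D)) ->
    derivable G ((X, Atom xs) +` D)
| d_andR X phi psi G D :
    derivable G ((X, phi) +` D) ->
    derivable G ((X, psi) +` D) ->
    derivable G ((X, And phi psi) +` D)
| d_andL X phi psi G D :
    derivable ((X, phi) +` ((X, psi) +` G)) D ->
    derivable ((X, And phi psi) +` G) D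
| d_iorR X phi psi G D :
    derivable G ((X, phi) +` ((X, psi) +` D)) ->
    derivable G ((X, IOr phi psi) +` D)
| d_iorL X phi psi G D :
    derivable ((X, phi) +` G) D ->
    derivable ((X, psi) +` G) D ->
    derivable ((X, IOr phi psi) +` G) D
| d_impR X phi psi G D :
    (forall Y, (val Y `<=` val X)%fset ->
       derivable ((Y, phi) +` G) ((Y, psi) +` D)) ->
    derivable G ((X, Imp phi psi) +` D)
| d_impL X Y phi psi G D :
    (val Y `<=` val X)%fset ->
    derivable ((X, Imp phi psi) +` G) ((Y, phi) +` D) ->
    derivable ((Y, psi) +` ((X, Imp phi psi) +` G)) D ->
    derivable ((X, Imp phi psi) +` G) D
| d_allR X x z phi G D :
    ~~ occurs z G -> ~~ occurs z ((X, All x phi) +` D) ->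
    derivable G ((X, subst z x phi) +` D) ->
    derivable G ((X, All x phi) +` D)
| d_allL X x y phi G D :
    derivable ((X, subst y x phi) +` ((X, All x phi) +` G)) D ->
    derivable ((X, All x phi) +` G) D
| d_exR X x y phi G D :
    derivable G ((X, IEx x phi) +` ((X, subst y x phi) +` D)) ->
    derivable G ((X, IEx x phi) +` D)
| d_exL X x z phi G D :
    ~~ occurs z ((X, IEx x phi) +` G) -> ~~ occurs z D ->
    derivable ((X, subst z x phi) +` G) D ->
    derivable ((X, IEx x phi) +` G) D.

(* [labelled X Psi] is the finite multiset X : Psi, in which each element of
   the finite set [Psi] is taken once. *)
Definition labelled X (Psi : {fset form ar}) : {mset lform} :=
  seq_mset [seq (X, psi) | psi <- Psi].

(* Derivability of a possibly infinite sequent, whose sides are sets. *)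
Definition derivable_inf (Gam Del : set lform) : Prop :=
  exists Gam' Del' : {fset lform},
    [/\ forall A, A \in Gam' -> Gam A,
        forall A, A \in Del' -> Del A &
        derivable (seq_mset Gam') (seq_mset Del')].

End Calculus.

(* Main.v *)
Require Import Defs.
From mathcomp Require Import all_boot.
From mathcomp Require Import finmap multiset.
From mathcomp Require Import boolp classical_sets cardinality.

(* If no finite part of the sequent is derivable, a fair proof search in which
   each stage replaces the head of a queue by what a suitable premise makes of
   it, and appends the result at the end, never reaches a derivable sequent. Its
   branch yields a countermodel: the worlds are 1, ..., n, the domain consists of
   all parameters, and the antecedent atoms of the branch are the true ones; a
   labelled formula of the branch is supported at its label if it stands in an
   antecedent and not supported if it stands in a succedent.
   The search handles formulas paired with an assignment of parameters, and the
   stock of eigenvariables is disjoint from the variables of the given formulas,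
   which may well exhaust [nat]. A sequent of such pairs is read as the
   derivability of all its instances, in all contexts. This makes weakening
   immediate. Contraction is never needed, because every formula of the queue is
   replaced once, and every hypothesis enters the queue only once. *)

Set Implicit Arguments.
Unset Strict Implicit.
Unset Printing Implicit Defensive.

(** * Equality up to bound variables and capture-avoiding substitution *)

Section AlphaSubst.
Variable ar : nat -> nat.
Implicit Types (phi psi : form ar) (r : nat -> nat).

(* [aeq r1 phi r2 psi]: [phi] under [r1] and [psi] under [r2] are the same
   formula up to bound variables. Letting the common value [d] of two matching
   bound variables be arbitrary, instead of fresh, makes instantiation immediate. *)
Fixpoint aeq r1 phi r2 psi : Prop :=
  match phi, psi with
  | Atom P xs, Atom Q ys => Atom (map_tuple r1 xs) = Atom (map_tuple r2 ys)
  | Bot, Bot => True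
  | Imp phi1 phi2, Imp psi1 psi2 => aeq r1 phi1 r2 psi1 /\ aeq r1 phi2 r2 psi2
  | And phi1 phi2, And psi1 psi2 => aeq r1 phi1 r2 psi1 /\ aeq r1 phi2 r2 psi2
  | IOr phi1 phi2, IOr psi1 psi2 => aeq r1 phi1 r2 psi1 /\ aeq r1 phi2 r2 psi2
  | All x phi1, All y psi1 =>
      forall d, aeq [eta r1 with x |-> d] phi1 [eta r2 with y |-> d] psi1
  | IEx x phi1, IEx y psi1 =>
      forall d, aeq [eta r1 with x |-> d] phi1 [eta r2 with y |-> d] psi1
  | _, _ => False
  end.

Lemma aeq_refl r phi : aeq r phi r phi.
Proof. by elim: phi r => //=. Qed.

Lemma aeq_ext phi psi r1 r2 r1' r2' :
    {in fv phi, r1 =1 r1'} -> {in fv psi, r2 =1 r2'} ->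
  aeq r1 phi r2 psi -> aeq r1' phi r2' psi.
Proof.
have catP (s t : seq nat) (f g : nat -> nat) :
    {in s ++ t, f =1 g} -> {in s, f =1 g} /\ {in t, f =1 g}.
  by move=> h; split=> x xs; apply: h; rewrite mem_cat xs ?orbT.
have bindP x d (s : seq nat) (f g : nat -> nat) :
    {in [seq y <- s | y != x], f =1 g} ->
    {in s, [eta f with x |-> d] =1 [eta g with x |-> d]}.
  move=> h y ys /=; case: (eqVneq y x) => //= nyx.
  by apply: h; rewrite mem_filter nyx.
elim: phi psi r1 r2 r1' r2' => [P xs||f1 IH1 f2 IH2|f1 IH1 f2 IH2|f1 IH1 f2 IH2|x f IH|x f IH]
  [Q ys||g1 g2|g1 g2|g1 g2|y g|y g] //= r1 r2 r1' r2' E1 E2.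
- have -> : map_tuple r1 xs = map_tuple r1' xs.
    by apply/val_inj => /=; apply/eq_in_map.
  have -> // : map_tuple r2 ys = map_tuple r2' ys.
    by apply/val_inj => /=; apply/eq_in_map.
- case: (catP _ _ _ _ E1) (catP _ _ _ _ E2) => ? ? [? ?] [/IH1 + /IH2].
  by move=> h1 h2; split; [apply: h1|apply: h2].
- case: (catP _ _ _ _ E1) (catP _ _ _ _ E2) => ? ? [? ?] [/IH1 + /IH2].
  by move=> h1 h2; split; [apply: h1|apply: h2].
- case: (catP _ _ _ _ E1) (catP _ _ _ _ E2) => ? ? [? ?] [/IH1 + /IH2].
  by move=> h1 h2; split; [apply: h1|apply: h2].
- by move=> h d; apply: IH (h d); apply: bindP.
- by move=> h d; apply: IH (h d); apply: bindP.
Qed.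

Lemma rebind_fresh (s : nat -> nat) x (ys : seq nat) y :
  y \in ys -> y != x -> s y != rebind s x ys.
Proof.
move=> yys yx; rewrite /rebind.
set im := map _ _.
have syim : s y \in im by apply: map_f; rewrite mem_filter yx.
case: ifP => [_|/negbT xim]; last by apply: contraNneq xim => <-.
rewrite neq_ltn ltnS.
by rewrite (leq_bigmax_seq (F := id) _ syim).
Qed.

Lemma aeq_ssubst phi psi r1 r2 s :
  aeq r1 phi (r2 \o s) psi -> aeq r1 phi r2 (ssubst s psi).
Proof.
(* By [rebind_fresh], no free variable other than [x] is sent to the new bound variable, so giving
   the latter the value [d] disturbs nothing else. *)
have bindE x d f (s0 : nat -> nat) r :
    {in fv f, [eta r \o s0 with x |-> d] =1
       [eta r with rebind s0 x (fv f) |-> d] \o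
         [eta s0 with x |-> rebind s0 x (fv f)]}.
  move=> z zf /=; case: (eqVneq z x) => [_|zx] /=; first by rewrite eqxx.
  by rewrite (negPf (rebind_fresh _ zf zx)).
elim: psi phi r1 r2 s => [Q ys||g1 IH1 g2 IH2|g1 IH1 g2 IH2|g1 IH1 g2 IH2|y g IH|y g IH]
  [P xs||f1 f2|f1 f2|f1 f2|x f|x f] //= r1 r2 s.
- by move=> ->; congr Atom; apply/val_inj; rewrite /= -map_comp.
- by case=> ? ?; split; auto.
- by case=> ? ?; split; auto.
- by case=> ? ?; split; auto.
- by move=> h d; apply: IH; apply: aeq_ext (h d) => //; apply: bindE.
- by move=> h d; apply: IH; apply: aeq_ext (h d) => //; apply: bindE.
Qed.

Lemma aeq_open r x phi y psi d :
    (forall d, aeq [eta r with x |-> d] phi [eta id with y |-> d] psi) ->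
  aeq [eta r with x |-> d] phi id (subst d y psi).
Proof. by move=> h; apply: aeq_ssubst; apply: h. Qed.

End AlphaSubst.

(** * Items of the proof search and their soundness for the calculus *)

Local Notation param := (nat + nat)%type.
Local Notation env := (seq (nat * (nat + nat))).

(* A parameter [inl x] is the variable [x] of the given formulas, and [inr m]
   is an eigenvariable. *)
Fixpoint lookup (e : env) : nat -> param :=
  if e is (x, d) :: e' then [eta lookup e' with x |-> d] else inl.

(* An item [(b, X, phi, e, c)] is the labelled formula [X : phi[e]], standing in
   the antecedent if [b] and in the succedent otherwise; the counter [c]
   numbers the instances of the rules that keep their principal formula. *)
Local Notation item ar := (bool * label * form ar * env * nat)%type.

Section Items.
Variable ar : nat -> nat.
Local Notation item := (item ar).
Implicit Types (phi psi : form ar) (e : env) (q : seq item) (it : item).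
Implicit Types (X Y : label) (b : bool) (z : param) (t : param -> nat).

Definition sublabels X : seq label :=
  pmap insub (fpowerset (val X)).

Lemma mem_sublabels X Y : (Y \in sublabels X) = (val Y `<=` val X)%fset.
Proof. by rewrite mem_pmap_sub fpowersetE. Qed.

(* The premises of the rule with principal formula [it] and eigenvariable [z],
   each given by what replaces [it]. *)
Definition prems z it : seq (seq item) :=
  let: (b, X, f, e, c) := it in
  let keep := (b, X, f, e, c.+1) in
  match f, b with
  | Atom P xs, true => [:: [:: it]]
  | Atom P xs, false => [seq [:: (false, label1 k, f, e, 0)] | k <- enum_fset (val X)]
  | Bot, true => [::]
  | Bot, false => [:: [:: it]]
  | Imp f1 f2, true =>
      if choice.unpickle c is Some Y then
        if (val Y `<=` val X)%fset
        then [:: [:: keep; (false, Y, f1, e, 0)]; [:: (true, Y, f2, e, 0); keep]]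
        else [:: [:: keep]]
      else [:: [:: keep]]
  | Imp f1 f2, false =>
      [seq [:: (true, Y, f1, e, 0); (false, Y, f2, e, 0)] | Y <- sublabels X]
  | And f1 f2, true => [:: [:: (b, X, f1, e, 0); (b, X, f2, e, 0)]]
  | And f1 f2, false => [:: [:: (b, X, f1, e, 0)]; [:: (b, X, f2, e, 0)]]
  | IOr f1 f2, true => [:: [:: (b, X, f1, e, 0)]; [:: (b, X, f2, e, 0)]]
  | IOr f1 f2, false => [:: [:: (b, X, f1, e, 0); (b, X, f2, e, 0)]]
  | All x f1, true =>
      if choice.unpickle c is Some d then [:: [:: (b, X, f1, (x, d) :: e, 0); keep]]
      else [:: [:: keep]]
  | IEx x f1, false =>
      if choice.unpickle c is Some d then [:: [:: keep; (b, X, f1, (x, d) :: e, 0)]]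
      else [:: [:: keep]]
  | All x f1, false | IEx x f1, true => [:: [:: (b, X, f1, (x, z) :: e, 0)]]
  end.

Local Notation sequent := ({mset (label * form ar)}%mset * {mset (label * form ar)}%mset)%type.
Local Notation derivable_seq S := (derivable S.1 S.2).

Definition add_side b (A : label * form ar) (S : sequent) : sequent :=
  if b then ((A +` S.1)%mset, S.2) else (S.1, (A +` S.2)%mset).

Lemma add_sideC b b' A A' S :
  add_side b A (add_side b' A' S) = add_side b' A' (add_side b A S).
Proof. by rewrite /add_side; case: b; case: b'; rewrite /= 1?(msetDCA [mset A]%mset). Qed.

Definition rep t e phi psi := aeq (t \o lookup e) phi id psi.

(* [S] contains instances of all items of [q]. The remaining formulas of [S]
   are arbitrary, so that weakening is built into [Der] below. *)
Fixpoint cov t q S : Prop :=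
  if q is (b, X, f, e, _) :: q' then
    exists g S', [/\ rep t e f g, S = add_side b (X, g) S' & cov t q' S']
  else True.

(* Quantifying over [t] builds in the renaming of eigenvariables. *)
Definition Der q := forall t S, cov t q S -> derivable_seq S.

(** Multiplicities are compared rather than membership, so that passing to a larger queue is
    weakening and exchange without contraction. *)
Definition submulti (q q' : seq item) := forall it, count_mem it q <= count_mem it q'.

Lemma cov_rem t q S it : it \in q -> cov t q S -> cov t (it :: rem it q) S.
Proof.
elim: q S => // a q IH S.
rewrite inE [rem _ _]/=; case: (eqVneq a it) => [->|nai] //; rewrite orFb => itq.
case: a nai => [[[[b X] f] e] c] nai /= [g [S' [rg -> /(IH _ itq)]]].
case: it {IH itq} nai => [[[[b' X'] f'] e'] c'] nai /= [g' [S'' [rg' -> cv]]].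
rewrite add_sideC; exists g', (add_side b (X, g) S''); split=> //.
by exists g, S''.
Qed.

(** The instances of the surplus items of [q'] are absorbed by the arbitrary remainder that [cov]
    allows at the end of [q]. *)
Lemma cov_submulti t q q' S : submulti q q' -> cov t q' S -> cov t q S.
Proof.
elim: q q' S => // a q IH q' S sub /=.
have aq' : a \in q'.
  by rewrite -has_pred1 has_count (leq_trans _ (sub a)) //= eqxx.
move/(cov_rem aq').
case: a aq' sub => [[[[b X] f] e] c] aq' sub /= [g [S' [rg -> cv]]].
exists g, S'; split=> //; apply: IH cv => it.
have:= sub it; rewrite count_rem aq' /= leq_subRL //.
by case: eqP => [<-|//]; rewrite -has_count has_pred1.
Qed.

Lemma Der_submulti q q' : submulti q q' -> Der q -> Der q'.
Proof. by move=> sub D t S /(cov_submulti sub)/D. Qed.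

Lemma Der_perm q q' : perm_eq q q' -> Der q -> Der q'.
Proof. by move/permP => E; apply: Der_submulti => it; rewrite E. Qed.

Lemma covL t X f e c q g G D :
  rep t e f g -> cov t q (G, D) -> cov t ((true, X, f, e, c) :: q) (((X, g) +` G)%mset, D).
Proof. by move=> rg cv; exists g, (G, D). Qed.

Lemma covR t X f e c q g G D :
  rep t e f g -> cov t q (G, D) -> cov t ((false, X, f, e, c) :: q) (G, ((X, g) +` D)%mset).
Proof. by move=> rg cv; exists g, (G, D). Qed.

Lemma Der_cov t q G D : Der q -> cov t q (G, D) -> derivable G D.
Proof. by move=> Dq /Dq. Qed.

Definition params it : seq param :=
  let: (b, X, f, e, c) := it in [seq lookup e x | x <- fv f].

Lemma cov_ext t t' q S :
  (forall it, it \in q -> {in params it, t =1 t'}) -> cov t q S -> cov t' q S.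
Proof.
elim: q S => // [[[[[b X] f] e] c] q] IH S E /= [g [S' [rg -> cv]]].
exists g, S'; split=> //; last first.
  by apply: IH cv => it itq; apply: E; rewrite inE itq orbT.
apply: aeq_ext rg => // x xf /=.
by apply: (E _ (mem_head _ _)); apply: map_f.
Qed.

Lemma fresh_var (S : sequent) : exists v : nat, ~~ occurs v S.1 && ~~ occurs v S.2.
Proof.
pose s := flatten [seq vars A.2 | A <- (S.1 : seq _) ++ (S.2 : seq _)].
exists (\max_(y <- s) y).+1.
suff occ (G : {mset (label * form ar)}%mset) :
    {subset (G : seq _) <= (S.1 : seq _) ++ (S.2 : seq _)} ->
    ~~ occurs (\max_(y <- s) y).+1 G.
  by rewrite !occ // => A AS; rewrite mem_cat AS ?orbT.
move=> sub; apply/hasPn => A AG; apply/negP => h.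
have : (\max_(y <- s) y).+1 \in s.
  by apply/flattenP; exists (vars A.2) => //; apply: map_f; apply: sub.
by move=> h'; have := leq_bigmax_seq (F := id) (P := xpredT) _ h' isT; rewrite ltnn.
Qed.

Lemma rep_eigen t z (z' x : nat) e f (y : nat) g :
    z \notin [seq lookup e v | v <- [seq v <- fv f | v != x]] ->
    (forall d, aeq [eta t \o lookup e with x |-> d] f [eta id with y |-> d] g) ->
  rep [eta t with z |-> z'] ((x, z) :: e) f (subst z' y g).
Proof.
move=> zf h; rewrite /rep; apply: aeq_ext (aeq_open z' h) => // v vf /=.
case: (eqVneq v x) => [_|vx] /=; first by rewrite eqxx.
case: eqP => // lz; case/negP: zf; apply/mapP; exists v; rewrite ?lz //.
by rewrite mem_filter vx.
Qed.

Lemma rep_inst t d x e f y g :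
    (forall d, aeq [eta t \o lookup e with x |-> d] f [eta id with y |-> d] g) ->
  rep t ((x, d) :: e) f (subst (t d) y g).
Proof.
move=> h; rewrite /rep; apply: aeq_ext (aeq_open (t d) h) => // v vf /=.
by case: eqP.
Qed.

(** The parameter [z] is fresh for the items only, whereas the rule wants a variable fresh for the
    actual sequent, context included. As [t] is arbitrary in [Der], its value at [z] can be
    redirected to such a variable without changing the other instances. *)
Lemma Der_eigen b X x z f e c q :
    let f' := if b then IEx x f else All x f in
    z \notin flatten (map params ((b, X, f', e, c) :: q)) ->
    Der ((b, X, f, (x, z) :: e, 0) :: q) -> Der ((b, X, f', e, c) :: q).
Proof.
move=> f'; rewrite /= mem_cat negb_or => /andP[zf zq] D t S /= [g [S' [rg -> cv]]].
have [z' /andP[fr1 fr2]] := fresh_var (add_side b (X, g) S').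
have {}cv : cov [eta t with z |-> z'] q S'.
  apply: cov_ext cv => it itq d dp /=; case: eqP => // dz.
  by case/negP: zq; apply/flattenP; exists (params it); rewrite -?dz //; apply: map_f.
have {}D g0 : rep [eta t with z |-> z'] ((x, z) :: e) f g0 ->
    derivable_seq (add_side b (X, g0) S').
  by move=> r0; apply: (D [eta t with z |-> z']); exists g0, S'.
case: S' {cv} fr1 fr2 D => G D' fr1 fr2 D.
rewrite {}/f' in zf rg; case: b zf rg fr1 fr2 D => zf; case: g => // y g rg fr1 fr2 D.
- rewrite /add_side /= in fr1 fr2 *.
  by apply: (d_exL fr1 fr2); apply: D; apply: rep_eigen rg.
- rewrite /add_side /= in fr1 fr2 *.
  by apply: (d_allR fr1 fr2); apply: D; apply: rep_eigen rg.
Qed.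

(** An instance of a formula has the same outermost connective, so the rule of the calculus applies
    to it, and its components are instances of the new items. *)
Lemma Der_prems z it q :
    z \notin flatten (map params (it :: q)) ->
    (forall new, new \in prems z it -> Der (new ++ q)) ->
  Der (it :: q).
Proof.
case: it => [[[[b X] f] e] c] zf.
have one (n : seq item) : (forall new, new \in [:: n] -> Der (new ++ q)) ->
    Der (n ++ q).
  by move=> h; apply: h; rewrite inE.
have two (n1 n2 : seq item) : (forall new, new \in [:: n1; n2] -> Der (new ++ q)) ->
    Der (n1 ++ q) /\ Der (n2 ++ q).
  by move=> h; split; apply: h; rewrite !inE eqxx ?orbT.
case: f zf => [P xs||f1 f2|f1 f2|f1 f2|x f|x f]; case: b => zf //.
- by move/one.
- move=> h t S /= [g [[G D] [rg -> cv]]];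
    rewrite /add_side /=; case: g rg => // Q ys rg.
  apply: d_atR => k kX.
  have Dk : Der ((false, label1 k, Atom xs, e, 0) :: q).
    apply: (h [:: (false, label1 k, Atom xs, e, 0)]).
    exact: (map_f (fun k => [:: (false, label1 k, Atom xs, e, 0)])).
  by apply: (Der_cov (t := t) Dk); apply: covR.
- by move=> h t S /= [g [[G D] [rg -> _]]];
    rewrite /add_side /=; case: g rg => // _; apply: d_botL.
- by move/one.
(* Counters are ignored by [cov]. *)
- have keepD : Der [:: (true, X, Imp f1 f2, e, c.+1) & q] ->
      Der [:: (true, X, Imp f1 f2, e, c) & q].
    by move=> D t S /D.
  rewrite /prems; case: choice.unpickle => [Y|]; last by move/one/keepD.
  case: ifP => [YX|_]; last by move/one/keepD.
  case/two => D1 D2 t S /= [g [[G D] [rg -> cv]]];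
    rewrite /add_side /=; case: g rg => // g1 g2 [r1 r2].
  apply: (d_impL YX).
    by apply: (Der_cov (t := t) D1); apply: covL => //; apply: covR.
  by apply: (Der_cov (t := t) D2); apply: covL => //; apply: covL.
- move=> h t S /= [g [[G D] [rg -> cv]]];
    rewrite /add_side /=; case: g rg => // g1 g2 [r1 r2].
  apply: d_impR => Y YX.
  have DY : Der [:: (true, Y, f1, e, 0), (false, Y, f2, e, 0) & q].
    apply: (h [:: (true, Y, f1, e, 0); (false, Y, f2, e, 0)]).
    by apply: (map_f (fun Y => [:: (true, Y, f1, e, 0); (false, Y, f2, e, 0)])); rewrite mem_sublabels.
  by apply: (Der_cov (t := t) DY); apply: covL => //; apply: covR.
- move/one => h t S /= [g [[G D] [rg -> cv]]];
    rewrite /add_side /=; case: g rg => // g1 g2 [r1 r2].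
  by apply: d_andL; apply: (Der_cov (t := t) h); apply: covL => //; apply: covL.
- case/two => D1 D2 t S /= [g [[G D] [rg -> cv]]];
    rewrite /add_side /=; case: g rg => // g1 g2 [r1 r2].
  by apply: d_andR; [apply: (Der_cov (t := t) D1)|apply: (Der_cov (t := t) D2)]; apply: covR.
- case/two => D1 D2 t S /= [g [[G D] [rg -> cv]]];
    rewrite /add_side /=; case: g rg => // g1 g2 [r1 r2].
  by apply: d_iorL; [apply: (Der_cov (t := t) D1)|apply: (Der_cov (t := t) D2)]; apply: covL.
- move/one => h t S /= [g [[G D] [rg -> cv]]];
    rewrite /add_side /=; case: g rg => // g1 g2 [r1 r2].
  by apply: d_iorR; apply: (Der_cov (t := t) h); apply: covR => //; apply: covR.
- have keepD : Der [:: (true, X, All x f, e, c.+1) & q] ->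
      Der [:: (true, X, All x f, e, c) & q].
    by move=> D t S /D.
  rewrite /prems; case: choice.unpickle => [d|]; last by move/one/keepD.
  move/one => h t S /= [g [[G D] [rg -> cv]]];
    rewrite /add_side /=; case: g rg => // y g rg.
  apply: (@d_allL _ _ _ (t d)); apply: (Der_cov (t := t) h).
  by apply: covL; [apply: rep_inst|apply: covL].
- by move/one; apply: (@Der_eigen false).
- by move/one; apply: (@Der_eigen true).
- have keepD : Der [:: (false, X, IEx x f, e, c.+1) & q] ->
      Der [:: (false, X, IEx x f, e, c) & q].
    by move=> D t S /D.
  rewrite /prems; case: choice.unpickle => [d|]; last by move/one/keepD.
  move/one => h t S /= [g [[G D] [rg -> cv]]];
    rewrite /add_side /=; case: g rg => // y g rg.
  apply: (@d_exR _ _ _ (t d)); apply: (Der_cov (t := t) h).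
  by apply: covR => //; apply: covR => //; apply: rep_inst.
Qed.

(** Equal tuples of parameters stay equal under every [t], so every covering sequent is initial. *)
Lemma Der_id X Y P (xs ys : (ar P).-tuple nat) e e' c c' q :
    (val Y `<=` val X)%fset ->
    map_tuple (lookup e) xs = map_tuple (lookup e') ys ->
    (true, X, Atom xs, e, c) \in q -> (false, Y, Atom ys, e', c') \in q ->
  Der q.
Proof.
move=> YX E xq yq.
apply: (@Der_submulti [:: (true, X, Atom xs, e, c); (false, Y, Atom ys, e', c')]).
  move=> it /=; rewrite addn0.
  case: eqP => [<-|_] /=; last by case: eqP => // <-; rewrite -has_count has_pred1.
  by rewrite addn0 -has_count has_pred1.
move=> t S /= [g [S' [r1 -> [h [[G D] [r2 -> _]]]]]]; rewrite /add_side /=.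
case: g h r1 r2 => // Q us [] // R vs r1 r2.
rewrite /rep /= in r1 r2.
have mapid R' (us0 : (ar R').-tuple nat) : map_tuple id us0 = us0.
  by apply/val_inj; rewrite /= map_id.
rewrite mapid in r1; rewrite mapid in r2.
rewrite -r1 -r2.
have <- : map_tuple (t \o lookup e) xs = map_tuple (t \o lookup e') ys.
  move/(congr1 (fun u => map t (val u))): E; rewrite /= -!map_comp => E.
  exact/val_inj.
exact: d_id.
Qed.

End Items.

Local Open Scope classical_set_scope.

(** * Fair saturation over a possibly infinite set of hypotheses *)

Section Completeness.
Variables (ar : nat -> nat) (n : nat) (n_gt0 : 0 < n) (Psi : set (form ar)).
Local Notation item := (item ar).
Local Notation N := (label_upto n_gt0).
Implicit Types (phi psi : form ar) (e : env) (q new : seq item) (it : item).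
Implicit Types (X Y : label) (s : seq (form ar)).

Definition hyp psi : item := (true, N, psi, [::], 0).

(** Unlike [unpickle], [pickle_inv] answers only at the actual code of [psi], so [hyp psi] is issued
    at a single stage. *)
Definition reserve k : seq item :=
  if pickle_inv k is Some psi then if `[< Psi psi >] then [:: hyp psi] else [::]
  else [::].

Definition available k s :=
  uniq s /\ forall psi, psi \in s -> Psi psi /\ k <= choice.pickle psi.

(* Before stage [k] of the saturation, exactly the elements of [Psi] with a code
   less than [k] have been used, hence each of them only once. *)
Definition DerPsi k q := exists2 s, available k s & Der (q ++ map hyp s).

Lemma hyp_inj : injective hyp.
Proof. by move=> psi psi' []. Qed.

Lemma Der_hyps q s s' :
  uniq s -> {subset s <= s'} -> Der (q ++ map hyp s) -> Der (q ++ map hyp s').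
Proof.
move=> us sub; apply: Der_submulti => it; rewrite !count_cat leq_add2l.
rewrite count_uniq_mem ?(map_inj_uniq hyp_inj) //.
case: (boolP (it \in _)) => //= /mapP[psi /sub ss ->].
by rewrite -has_count has_pred1 map_f.
Qed.

(** The hypothesis issued at stage [k] moves into the list [s]; the codes already there exceed [k],
    so no duplicate arises. *)
Lemma DerPsi_hyp_code k q : DerPsi k.+1 (q ++ reserve k) -> DerPsi k q.
Proof.
case=> s [us av]; rewrite /reserve.
have avS : available k s by split=> // psi /av[? /ltnW].
case E: pickle_inv => [psi|]; last by rewrite cats0; exists s.
have codepsi : choice.pickle psi = k by have := @pickle_invK (form ar) k; rewrite E.
case: asboolP => [Ppsi|_]; last by rewrite cats0; exists s.
rewrite -catA => D; exists (psi :: s) => //; split=> /=.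
  rewrite us andbT; apply/negP => /av[_].
  by rewrite codepsi ltnn.
move=> psi'; rewrite inE => /orP[/eqP ->|/avS.2 //]; by rewrite codepsi.
Qed.

(** Branching is finite, so the duplicate-free union of the lists used by the single premises serves
    them all. *)
Lemma DerPsi_merge k q (L : seq (seq item)) :
    (forall new, new \in L -> DerPsi k (new ++ q)) ->
  exists2 s, available k s & forall new, new \in L -> Der (new ++ q ++ map hyp s).
Proof.
elim: L => [|new L IH] h; first by exists [::].
have [s1 av1 D1] := h _ (mem_head _ _).
have [|s2 av2 D2] := IH; first by move=> new' iL; apply: h; rewrite inE iL orbT.
exists (undup (s1 ++ s2)).
  split=> [|psi]; first exact: undup_uniq.
  by rewrite mem_undup mem_cat => /orP[/av1.2|/av2.2].
move=> new'; rewrite inE catA => /orP[/eqP ->|/D2].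
  by apply: Der_hyps D1; rewrite ?av1.1 // => psi ?;
    rewrite mem_undup mem_cat; apply/orP; left.
by rewrite catA; apply: Der_hyps; rewrite ?av2.1 // => psi ?;
  rewrite mem_undup mem_cat; apply/orP; right.
Qed.

Lemma fresh_param (d : seq param) : exists m, inr m \notin d.
Proof.
pose l := pmap (fun p : param => if p is inr m then Some m else None) d.
exists (\max_(m <- l) m).+1; apply/negP => h.
have : (\max_(m <- l) m).+1 \in l by rewrite mem_pmap; apply: (map_f _ h).
by move=> h'; have := leq_bigmax_seq (F := id) (P := xpredT) _ h' isT; rewrite ltnn.
Qed.

Definition step k q q' :=
  if q is it :: q0 then
    exists m new, new \in prems (inr m) it /\ q' = q0 ++ new ++ reserve k
  else q' = reserve k.

Lemma step_ex k q : ~ DerPsi k q -> exists q', ~ DerPsi k.+1 q' /\ step k q q'.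
Proof.
case: q => [|it q] nD.
  by exists (reserve k); split=> // /(@DerPsi_hyp_code k [::]).
apply: contrapT => no; apply: nD.
have [m fr] := fresh_param (flatten (map (@params ar) (it :: q))).
have /DerPsi_merge[s av D] : forall new, new \in prems (inr m) it -> DerPsi k (new ++ q).
  move=> new newp; apply: DerPsi_hyp_code; apply: contrapT => nD; apply: no.
  exists (q ++ new ++ reserve k); split; last by exists m, new.
  case=> s av D; apply: nD; exists s => //.
  by apply: Der_perm D; rewrite -!catA perm_catCA.
exists s => //; apply: Der_prems D.
(* Hypotheses carry the empty environment, so their parameters are all of the form [inl] and [inr m]
   is fresh for them too. *)
rewrite map_cons map_cat; apply/negP => /flattenP[l].
rewrite in_cons mem_cat orbA => /orP[lq|]; last first.
  by case/mapP=> it' /mapP[psi _ ->] -> /mapP[].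
by move=> ml; case/negP: fr; apply/flattenP; exists l.
Qed.

Lemma saturation q : ~ DerPsi 0 q ->
  exists Q : nat -> seq item,
    Q 0 = q /\ forall k, ~ DerPsi k (Q k) /\ step k (Q k) (Q k.+1).
Proof.
move=> nD.
have [f fP] : {f : nat * seq item -> seq item & forall p, ~ DerPsi p.1 p.2 ->
    ~ DerPsi p.1.+1 (f p) /\ step p.1 p.2 (f p)}.
  apply: (choice (P := fun p q' => ~ DerPsi p.1 p.2 ->
    ~ DerPsi p.1.+1 q' /\ step p.1 p.2 q')).
  move=> [k p]; case: (pselect (DerPsi k p)) => [D|/step_ex[q' h]]; first by exists [::].
  by exists q'.
pose Q := fix Q k := if k is k'.+1 then f (k', Q k') else q.
exists Q; split=> // k.
have nQ : ~ DerPsi k (Q k) by elim: k => //= k /(fP (k, _))[].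
by split=> //; case: (fP (k, Q k) nQ).
Qed.

(** * The countermodel read off a saturated branch *)

Section Countermodel.
Variable Q : nat -> seq item.
Hypothesis QP : forall k, ~ DerPsi k (Q k) /\ step k (Q k) (Q k.+1).

Definition occ it := exists k, it \in Q k.

(** Fairness: each stage removes the head and appends at the end, so an item preceded by [q] becomes
    the head after [size q] stages. *)
Lemma occ_head k q it q' : Q k = q ++ it :: q' -> exists j q'', Q j = it :: q''.
Proof.
elim: q k q' => [|a q IH] k q' E; first by exists k, q'.
case: (QP k) => _; rewrite E /= => -[m [new [_ Ek]]].
by apply: (IH k.+1 (q' ++ new ++ reserve k)); rewrite Ek -catA.
Qed.

Lemma occ_prems it : occ it ->
  exists m new, new \in prems (inr m) it /\ forall it', it' \in new -> occ it'.
Proof.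
case=> k itk.
have [j [q'' Ej]] : exists j q'', Q j = it :: q''.
  by case/path.splitPr E : {1}(Q k) / itk => [p1 p2]; apply: (occ_head E).
case: (QP j) => _; rewrite Ej => -[m [new [newp Ej1]]].
exists m, new; split=> // it' itn; exists j.+1.
by rewrite Ej1 !mem_cat itn orbT.
Qed.

(** Applied to antecedent atoms and singleton succedent atoms: two of them that enter at different
    stages end up in one queue. *)
Lemma stable_mem it j k :
    (forall z new, new \in prems z it -> new = [:: it]) ->
  j <= k -> it \in Q j -> it \in Q k.
Proof.
move=> st; elim: k => [|k IH]; first by rewrite leqn0 => /eqP ->.
rewrite leq_eqVlt => /orP[/eqP -> //|/IH{}IH /IH]; case: (QP k) => _.
case: (Q k) => // a q [m [new [newp ->]]].
rewrite inE => /orP[/eqP ia|iq]; last by rewrite mem_cat iq.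
by rewrite -ia in newp; rewrite (st _ _ newp) !mem_cat inE eqxx orbT.
Qed.

Lemma occ_consistent X k P (xs ys : (ar P).-tuple nat) e e' :
    occ (true, X, Atom xs, e, 0) -> occ (false, label1 k, Atom ys, e', 0) ->
  k \in val X -> map_tuple (lookup e) xs = map_tuple (lookup e') ys -> False.
Proof.
case=> i xi [j yj] kX E.
have {}xi : (true, X, Atom xs, e, 0) \in Q (maxn i j).
  by apply: stable_mem xi; rewrite ?leq_maxl // => z new; rewrite inE => /eqP.
have {}yj : (false, label1 k, Atom ys, e', 0) \in Q (maxn i j).
  apply: stable_mem yj; rewrite ?leq_maxr // => z new /mapP[k'].
  by rewrite /= inE => /eqP -> ->.
case: (QP (maxn i j)) => nD _; apply: nD; exists [::] => //=.
rewrite cats0; apply: Der_id E xi yj.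
by apply/fsubsetP => k'; rewrite inE => /eqP ->.
Qed.

(** The kept formula returns with its counter raised by one, so every code of a label or parameter
    gets its turn. *)
Lemma occ_counter b X phi e c :
    (forall z c' new, new \in prems z (b, X, phi, e, c') ->
       (b, X, phi, e, c'.+1) \in new) ->
  occ (b, X, phi, e, 0) -> occ (b, X, phi, e, c).
Proof.
move=> keep oc; elim: c => // c /occ_prems[m [new [/keep h]]].
by apply.
Qed.

(** The world [w] of ['I_n] stands for the label element [w.+1], as ordinals start at 0 and the
    labels in question at 1. *)
Definition countermodel : model ar :=
  @Model ar 'I_n param (inhabits (Ordinal n_gt0)) (inhabits (inl 0))
    (fun P w ds => exists X xs e,
       [/\ occ (true, X, Atom xs, e, 0), w.+1 \in val X & ds = map_tuple (lookup e) xs]).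

Definition state X : set (world countermodel) := [set w : 'I_n | w.+1 \in val X].

Lemma state_world X k : (val X `<=` val N)%fset -> k \in val X ->
  exists2 w : 'I_n, k = w.+1 & state X w.
Proof.
move=> XN kX; have := fsubsetP XN _ kX.
rewrite !inE mem_iota add1n ltnS => /andP[k0 kn].
have kn' : k.-1 < n by rewrite prednK.
have E : k = (Ordinal kn').+1 by rewrite /= prednK.
by exists (Ordinal kn') => //; rewrite /state /= prednK.
Qed.

Lemma state_neq0 X : (val X `<=` val N)%fset -> state X <> set0.
Proof.
move=> XN; case/fset0Pn: (valP X) => k /(state_world XN)[w _ wX] X0.
by rewrite X0 in wX.
Qed.

Lemma state_sub X Y : (val Y `<=` val X)%fset -> state Y `<=` state X.
Proof. by move=> YX w; apply: (fsubsetP YX). Qed.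

(** Matches the substates over which implication quantifies with the labels in its rules; the empty
    state has no label and is left to [supports_set0]. *)
Lemma state_surj X (t : set (world countermodel)) : t `<=` state X -> t <> set0 ->
  exists2 Y, (val Y `<=` val X)%fset & state Y = t.
Proof.
move=> tX t0.
pose Z := [fset k in val X | `[< exists2 w : 'I_n, t w & k = w.+1 >]]%fset.
have ZP (w : 'I_n) : (w.+1 \in Z) = `[< t w >].
  rewrite !inE /=; apply/andP/asboolP => [[_ /asboolP[w' tw' [/val_inj ->]]] //|tw].
  by split; [apply: tX|apply/asboolP; exists w].
have Z0 : Z != fset0.
  have [w tw] : exists w, t w by apply/set0P/eqP.
  by apply/fset0Pn; exists (w : 'I_n).+1; rewrite ZP; apply/asboolP.
exists (Sub Z Z0); rewrite /= ?SubK.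
  by apply/fsubsetP => k; rewrite !inE => /andP[].
by apply/seteqP; split=> w; rewrite /state /= ZP => /asboolP.
Qed.

Lemma supports_set0 (M : model ar) (g : nat -> dom M) phi : supports set0 g phi.
Proof.
elim: phi g => //= [f1 IH1 f2 IH2|f1 IH1 f2 IH2|x f IH] g.
- by move=> t; rewrite subset0 => ->.
- by left.
- by case: (dom_inh M) => d; exists d.
Qed.

(** Both halves are proved in one induction because implication moves its premise to the other
    side. *)
Lemma truth phi X e : (val X `<=` val N)%fset ->
  (occ (true, X, phi, e, 0) -> supports (state X) (lookup e) phi) /\
  (occ (false, X, phi, e, 0) -> ~ supports (state X) (lookup e) phi).
Proof.
elim: phi X e => [P xs||f1 IH1 f2 IH2|f1 IH1 f2 IH2|f1 IH1 f2 IH2|x f IH|x f IH] X e XN.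
- split=> [oc w wX|/occ_prems[m [_ [/mapP[k kX ->] oc]]]]; first by exists X, xs, e.
  (* Truth at the world of [k] would come from an antecedent atom with the same parameters, clashing
     with the succedent atom at [label1 k]. *)
  have [w E wX] := state_world XN kX; move=> /(_ w wX)[Y [ys [e' [oc' wY Exy]]]].
  apply: (occ_consistent oc' (oc _ (mem_head _ _))); last by rewrite -Exy.
  by rewrite E.
- split=> [/occ_prems[m [new []]] //|_]; exact: state_neq0.
- split=> [oc t tX s1|/occ_prems[m [new [/mapP[Y]]]]].
    have [E|t0] := pselect (t = set0); first by rewrite E; apply: supports_set0.
    have [Y YX YE] := state_surj tX t0.
    have YN := fsubset_trans YX XN.
    (* At this counter the rule for implication is applied with the label [Y]. *)
    have : occ (true, X, Imp f1 f2, e, choice.pickle Y).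
      apply: occ_counter oc => z c new; rewrite /prems.
      case: choice.unpickle => [Z|]; last by rewrite inE => /eqP ->; rewrite inE.
      by case: ifP => _; rewrite !inE; [case/orP=> /eqP|move/eqP]; move=> ->;
        rewrite !inE eqxx ?orbT.
    case/occ_prems=> m [new []]; rewrite /prems choice.pickleK YX !inE => /orP[] /eqP -> oc'.
      have /(IH1 _ _ YN).2 : occ (false, Y, f1, e, 0) by apply: oc'; rewrite !inE eqxx orbT.
      by rewrite YE.
    have /(IH2 _ _ YN).1 : occ (true, Y, f2, e, 0) by apply: oc'; rewrite !inE eqxx.
    by rewrite YE.
  rewrite mem_sublabels => YX -> oc /(_ _ (state_sub YX)).
  have YN := fsubset_trans YX XN.
  have /(IH1 _ _ YN).1 s1 : occ (true, Y, f1, e, 0) by apply: oc; rewrite !inE eqxx.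
  have /(IH2 _ _ YN).2 s2 : occ (false, Y, f2, e, 0) by apply: oc; rewrite !inE eqxx orbT.
  by move/(_ s1).
- split=> /occ_prems[m [new []]]; rewrite !inE.
    move/eqP-> => oc; split; [apply: (IH1 _ _ XN).1|apply: (IH2 _ _ XN).1]; apply: oc.
      by rewrite !inE eqxx.
    by rewrite !inE eqxx orbT.
  case/orP=> /eqP -> oc [s1 s2].
    by apply: (IH1 _ _ XN).2 s1; apply: oc; rewrite inE.
  by apply: (IH2 _ _ XN).2 s2; apply: oc; rewrite inE.
- split=> /occ_prems[m [new []]]; rewrite !inE.
    case/orP=> /eqP -> oc.
      by left; apply: (IH1 _ _ XN).1; apply: oc; rewrite inE.
    by right; apply: (IH2 _ _ XN).1; apply: oc; rewrite inE.
  move/eqP-> => oc [].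
    by apply: (IH1 _ _ XN).2; apply: oc; rewrite !inE eqxx.
  by apply: (IH2 _ _ XN).2; apply: oc; rewrite !inE eqxx orbT.
- split=> [oc d|/occ_prems[m [new []]]].
    have : occ (true, X, All x f, e, choice.pickle (d : param)).
      apply: occ_counter oc => z c new; rewrite /prems.
      by case: choice.unpickle => [d'|]; rewrite inE => /eqP ->; rewrite !inE eqxx ?orbT.
    case/occ_prems=> m [new []]; rewrite /prems choice.pickleK inE => /eqP -> oc'.
    by apply: (IH _ ((x, d) :: e) XN).1; apply: oc'; rewrite !inE eqxx.
  (* The eigenvariable itself is the element refuting the universal formula. *)
  rewrite inE => /eqP -> oc /(_ (inr m)).
  by apply: (IH _ ((x, inr m) :: e) XN).2; apply: oc; rewrite inE.
- split=> [/occ_prems[m [new []]]|oc [d sd]].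
    rewrite inE => /eqP -> oc; exists (inr m).
    by apply: (IH _ ((x, inr m) :: e) XN).1; apply: oc; rewrite inE.
  have : occ (false, X, IEx x f, e, choice.pickle (d : param)).
    apply: occ_counter oc => z c new; rewrite /prems.
    by case: choice.unpickle => [d'|]; rewrite inE => /eqP ->; rewrite !inE eqxx ?orbT.
  case/occ_prems=> m [new []]; rewrite /prems choice.pickleK inE => /eqP -> oc'.
  by apply: (IH _ ((x, d) :: e) XN).2 sd; apply: oc'; rewrite !inE eqxx orbT.
Qed.

Lemma occ_hyp psi : Psi psi -> occ (hyp psi).
Proof.
move=> Ppsi; exists (choice.pickle psi).+1.
have hr : hyp psi \in reserve (choice.pickle psi).
  by rewrite /reserve pickleK_inv; case: asboolP => // _; rewrite inE.
case: (QP (choice.pickle psi)) => _; case: (Q _) => [/= -> //|a q [m [new [_ ->]]]].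
by rewrite !mem_cat hr !orbT.
Qed.

Lemma countermodel_size : at_most_worlds n countermodel.
Proof. by have /card_eqPle[] := @card_II n. Qed.

End Countermodel.

(** * From the failed search back to finite sequents of the calculus *)

Lemma entails_Der phi : entails n Psi phi ->
  exists2 s, uniq s /\ (forall psi, psi \in s -> Psi psi) &
    Der ((false, N, phi, [::], 0) :: map hyp s).
Proof.
move=> ent.
have [[s [us av] D]|/saturation[Q [Q0 QP]]] :=
  pselect (DerPsi 0 [:: (false, N, phi, [::], 0)]).
  by exists s => //; split=> // psi /av[].
have := (truth QP phi [::] (fsubset_refl _)).2; case.
  by exists 0; rewrite Q0 inE.
apply: (ent (countermodel Q) (countermodel_size Q)) => psi Ppsi.
by apply: (truth QP psi [::] (fsubset_refl _)).1; apply: (occ_hyp QP).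
Qed.

Lemma entails_derivable phi : entails n Psi phi ->
  exists2 s, uniq s /\ (forall psi, psi \in s -> Psi psi) &
    derivable (seq_mset [seq (N, psi) | psi <- s]) [mset (N, phi)]%mset.
Proof.
case/entails_Der=> s sP D; exists s => //.
(* Variables are sent to themselves, so under the empty environment each formula is its own
   instance; 0 is a dummy value for eigenvariables. *)
pose t (p : param) := if p is inl v then v else 0.
apply: (Der_cov (t := t) D).
rewrite -[[mset _]%mset]msetD0; apply: covR; first exact: (aeq_refl id).
elim: s {sP D} => // psi s IH; rewrite !map_cons mset_cons.
by apply: covL; [exact: (aeq_refl id)|exact: IH].
Qed.

End Completeness.

Lemma seq_mset_fset (K : choiceType) (s : seq K) (A : {fset K}) :
  uniq s -> A =i s -> seq_mset A = seq_mset s.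
Proof.
by move=> us E; apply/eq_seq_msetP/uniq_perm.
Qed.

Lemma seq_mset_nil (K : choiceType) : seq_mset [::] = mset0 :> {mset K}%mset.
Proof. by apply/msetP => A; rewrite mset_seqE mset0E. Qed.

Theorem theorem5 (ar : nat -> nat) (n : nat) (n_ge1 : 1 <= n)
    (Psi : set (form ar)) (phi : form ar) :
  (entails n Psi phi ->
     derivable_inf
       [set (label_upto n_ge1, psi) | psi in Psi]%classic
       [set (label_upto n_ge1, phi)]%classic
     /\ exists Psi' : {fset form ar},
          (forall psi, psi \in Psi' -> Psi psi) /\
          derivable (labelled (label_upto n_ge1) Psi')
                    [mset (label_upto n_ge1, phi)]%mset)
  /\ (InqBQ n phi ->
        derivable mset0 [mset (label_upto n_ge1, phi)]%mset).
Proof.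
split=> [/(entails_derivable n_ge1)[s [us sP] D]|val_phi].
  split.
    exists [fset A in [seq (label_upto n_ge1, psi) | psi <- s]]%fset.
    exists [fset (label_upto n_ge1, phi)]%fset; split.
    - by move=> A; rewrite !inE => /mapP[psi /sP Ppsi ->]; exists psi.
    - by move=> A; rewrite !inE => /eqP ->.
    have -> : seq_mset [fset A in [seq (label_upto n_ge1, psi) | psi <- s]]%fset =
        seq_mset [seq (label_upto n_ge1, psi) | psi <- s].
      apply: seq_mset_fset => [|A]; last by rewrite !inE.
      by rewrite map_inj_uniq // => psi psi' [].
    have -> : seq_mset [fset (label_upto n_ge1, phi)]%fset =
        [mset (label_upto n_ge1, phi)]%mset.
      rewrite (@seq_mset_fset _ [:: (label_upto n_ge1, phi)]) // => [|A];
        last by rewrite !inE.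
      by rewrite mset_cons seq_mset_nil msetD0.
    exact: D.
  exists [fset psi in s]%fset; split=> [psi|]; first by rewrite !inE => /sP.
  rewrite /labelled (_ : seq_mset _ = seq_mset [seq (label_upto n_ge1, psi) | psi <- s]) //.
  apply/eq_seq_msetP/perm_map/uniq_perm => // [|psi]; first exact: fset_uniq.
  by rewrite !inE.
have ent : entails n (set0 : set (form ar)) phi.
  by move=> M Mn g s _; apply: val_phi.
(* The list of hypotheses is drawn from the empty set, hence empty. *)
have [[|psi s] [_ sP] D] := entails_derivable n_ge1 ent.
  by rewrite seq_mset_nil in D.
by case: (sP psi (mem_head _ _)).
Qed.
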